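(* Let $n\ge2$, $\alpha,\beta>0$, $\alpha^2+\beta^2=1$, and $\gamma\in[0,1]$. Apply to $\rho_n(\gamma)$ the following procedure: measure the commuting Pauli operators $Z_iZ_{i+1}$, $i=1,\dots,n-1$, and postselect on all outcomes $+1$; then apply CNOT gates with qubit 1 as control and each of qubits $2,\dots,n$ as target; then discard qubits $2,\dots,n$. The postselection succeeds with probability $P_0+P_n\ge\alpha^2$, and the resulting single-qubit state is $$\tilde\rho(\gamma)=\frac1{P_0+P_n}\begin{pmatrix}P_0&c\\ c&P_n\end{pmatrix},$$ with Bloch coordinates $x=2c/(P_0+P_n)$, $y=0$, $z=(P_0-P_n)/(P_0+P_n)$. Moreover $$\rho_n(\gamma)\notin\mathcal S\iff \tilde\rho(\gamma)\notin\mathcal O\iff |x|+|z|>1\iff c>\min(P_0,P_n),$$ and $$(P_0+P_n)\bigl[\mathcal R(\tilde\rho(\gamma))-1\bigr]=\mathcal R(\rho_n(\gamma))-1.$$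
   Context: The single-qubit amplitude-damping channel $\mathcal E_\gamma$ has Kraus operators $E_0=|0\rangle\langle0|+\sqrt{1-\gamma}\,|1\rangle\langle1|$, $E_1=\sqrt{\gamma}\,|0\rangle\langle1|$. $\rho_n(\gamma)=\mathcal E_\gamma^{\otimes n}(|\psi_n\rangle\langle\psi_n|)$ with $|\psi_n\rangle=\alpha|0^n\rangle+\beta|1^n\rangle$; $P_0=\alpha^2+\beta^2\gamma^n$, $P_n=\beta^2(1-\gamma)^n$, $c=\alpha\beta(1-\gamma)^{n/2}$ are its entries $\langle0^n|\rho|0^n\rangle,\langle1^n|\rho|1^n\rangle,\langle0^n|\rho|1^n\rangle$. $\mathcal S$ is the $n$-qubit stabilizer polytope (convex hull of pure stabilizer states $C|0^n\rangle$, $C$ Clifford); $\mathcal O$ is the single-qubit stabilizer octahedron $\{\frac12(I+xX+yY+zZ):|x|+|y|+|z|\le1\}$. The robustness of magic is $\mathcal R(\rho)=\min\{\sum_j|q_j|:\rho=\sum_jq_j\sigma_j,\ q_j\in\mathbb R,\ \sigma_j$ in the stabilizer polytope of the appropriate number of qubits$\}$. *)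

(* Defs.v *)
From HB Require Import structures.
From mathcomp Require Import all_boot all_order all_algebra.
From mathcomp Require Import classical_sets reals.
From mathcomp Require Import complex.
Set Implicit Arguments. Unset Strict Implicit. Unset Printing Implicit Defensive.
Import Order.TTheory GRing.Theory Num.Theory.
Local Open Scope ring_scope.
Local Open Scope complex_scope.

Section Qubits.
Variable R : realType.
Local Notation C := (R[i]).

Definition rc (x : R) : C := x%:C.

(* computational basis of n qubits: bit strings; qubit j (0-based) is
   entry j.  Qubit "1" of the paper is index 0. *)
Definition bits n := (n.-tuple bool).
Definition bit n (b : bits n) (j : nat) : bool := nth false b j.

Definition op n := bits n -> bits n -> C.
Definition vec n := bits n -> C.

Definition opI n : op n := fun a b => (a == b)%:R.
Definition opadd n (A B : op n) : op n := fun a b => A a b + B a b.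
Definition opscale n (s : C) (A : op n) : op n := fun a b => s * A a b.
Definition opmul n (A B : op n) : op n :=
  fun a b => \sum_(c : bits n) A a c * B c b.
Definition adj n (A : op n) : op n := fun a b => conjc (A b a).
Definition trace n (A : op n) : C := \sum_(a : bits n) A a a.
Definition opapp n (A : op n) (v : vec n) : vec n :=
  fun a => \sum_(b : bits n) A a b * v b.
Definition proj n (v : vec n) : op n := fun a b => v a * conjc (v b).

Definition flipb n (j : nat) (b : bits n) : bits n :=
  [tuple if (i : nat) == j then ~~ tnth b i else tnth b i | i < n].

(* gates acting on qubit j (or control c, target t); entry (a,b) = <a|G|b> *)
Definition Hgate n (j : nat) : op n := fun a b =>
  ((a == b) || (a == flipb j b))%:R
  * (if bit a j && bit b j then -1 else 1) / rc (Num.sqrt 2).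
Definition Sgate n (j : nat) : op n := fun a b =>
  (a == b)%:R * (if bit b j then 'i else 1).
Definition CNOT n (c t : nat) : op n := fun a b =>
  (a == (if bit b c then flipb t b else b))%:R.

Definition clifford_gen n (G : op n) : Prop :=
  (exists j, (j < n)%N /\ G = @Hgate n j) \/
  (exists j, (j < n)%N /\ G = @Sgate n j) \/
  (exists c t, [/\ (c < n)%N, (t < n)%N, c != t & G = @CNOT n c t]).

Definition ket0 n : vec n := fun b => (b == [tuple of nseq n false])%:R.

Inductive stab_vec n : vec n -> Prop :=
  | stab_vec0 : stab_vec (@ket0 n)
  | stab_vec_step (G : op n) (v : vec n) :
      clifford_gen G -> stab_vec v -> stab_vec (opapp G v).

Definition in_stab_poly n (rho : op n) : Prop :=
  exists (k : nat) (p : 'I_k -> R) (v : 'I_k -> vec n),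
    [/\ forall j, 0 <= p j, \sum_j p j = 1, forall j, stab_vec (v j) &
        rho = fun a b => \sum_j rc (p j) * proj (v j) a b].

Definition robustness n (rho : op n) : R :=
  inf [set r : R | exists (k : nat) (q : 'I_k -> R) (sigma : 'I_k -> op n),
    [/\ forall j, in_stab_poly (sigma j),
        rho = (fun a b => \sum_j rc (q j) * sigma j a b) &
        r = \sum_j `|q j| ]].

Definition pauliX : op 1 := fun a b => (bit a 0 != bit b 0)%:R.
Definition pauliY : op 1 := fun a b =>
  if bit a 0 == bit b 0 then 0 else if bit a 0 then 'i else - 'i.
Definition pauliZ : op 1 := fun a b =>
  (a == b)%:R * (if bit a 0 then -1 else 1).
Definition bloch (x y z : R) : op 1 := fun a b =>
  rc (1/2) * (@opI 1 a b + rc x * pauliX a b + rc y * pauliY a b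
              + rc z * pauliZ a b).
Definition in_octahedron (rho : op 1) : Prop :=
  exists x y z : R, `|x| + `|y| + `|z| <= 1 /\ rho = bloch x y z.

(* amplitude damping: Kraus entries <r|E_k|s> *)
Definition kraus (g : R) (k r s : bool) : C :=
  if k then (if ~~ r && s then rc (Num.sqrt g) else 0)
  else (if r == s then (if r then rc (Num.sqrt (1 - g)) else 1) else 0).
Definition krausN n (g : R) (k : bits n) : op n := fun a b =>
  \prod_(j < n) kraus g (tnth k j) (tnth a j) (tnth b j).
Definition ampdamp n (g : R) (rho : op n) : op n :=
  fun a b => \sum_(k : bits n)
    opmul (opmul (krausN g k) rho) (adj (krausN g k)) a b.

Definition psi n (al be : R) : vec n := fun b =>
  if all negb b then rc al else if all id b then rc be else 0.
Definition rho_n n (al be g : R) : op n := ampdamp g (proj (@psi n al be)).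

Definition ZZ n (j : nat) : op n := fun a b =>
  (a == b)%:R * (if bit a j == bit a j.+1 then 1 else -1).
(* projector onto the all +1 outcome of Z_iZ_{i+1}, i = 1..n-1 *)
Definition postsel_proj n : op n :=
  \big[@opmul n/@opI n]_(j < n.-1) opscale (rc (1/2)) (opadd (@opI n) (@ZZ n j)).
Definition post_unnorm n (rho : op n) : op n :=
  opmul (opmul (@postsel_proj n) rho) (@postsel_proj n).
Definition post_prob n (rho : op n) : C := trace (post_unnorm rho).
Definition cnot_chain n : op n := \big[@opmul n/@opI n]_(1 <= t < n) @CNOT n 0 t.
Definition ptrace_keep1 n (M : op n) : op 1 := fun a b =>
  \sum_(x : bits n) \sum_(y : bits n |
     [&& bit x 0 == bit a 0, bit y 0 == bit b 0 & behead x == behead y])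
     M x y.
Definition procedure n (rho : op n) : op 1 :=
  opscale (post_prob rho)^-1
    (ptrace_keep1 (opmul (opmul (@cnot_chain n) (post_unnorm rho))
                         (adj (@cnot_chain n)))).

Definition P0 n (al be g : R) : R := al ^+ 2 + be ^+ 2 * g ^+ n.
Definition Pn n (al be g : R) : R := be ^+ 2 * (1 - g) ^+ n.
Definition coh n (al be g : R) : R := al * be * (Num.sqrt (1 - g)) ^+ n.

Definition rho_tilde_formula n (al be g : R) : op 1 := fun a b =>
  rc ((P0 n al be g + Pn n al be g)^-1) *
  rc (if bit a 0 then (if bit b 0 then Pn n al be g else coh n al be g)
      else (if bit b 0 then coh n al be g else P0 n al be g)).

End Qubits.

(* Main.v *)
(* A damped GHZ state is diagonal except for one coherence [c] between [|0..0>]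
   and [|1..1>].  The procedure extracts its block on the repetition code: with
   [p = P0 + Pn], the state is [p] times the encoded output plus basis states of
   total weight [1 - p].  Encoding an optimal decomposition of the output thus
   gives [R(rho) - 1 <= p (R(out) - 1)].  Conversely the block of a pure
   stabilizer projector is a multiple [m <= 1] of a one-qubit stabilizer
   projector, and comparing traces shows that the lost weight costs at least
   [1 - p] in any decomposition of the state.

   Both the block statement and the bound [c <= min(P0, Pn)] on the stabilizer
   polytope follow from one fact: two nonzero amplitudes of a stabilizer vector
   differ by a power of [i].  It is derived from an invariant of Clifford gates:
   a Pauli operator either fixes the vector up to a power of [i] or has
   expectation zero in it. *)
Require Import Defs.
From HB Require Import structures.
From mathcomp Require Import all_boot all_order all_algebra.
From mathcomp Require Import boolp classical_sets reals.
From mathcomp Require Import complex.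
From mathcomp Require Import ring lra.
Set Implicit Arguments.
Unset Strict Implicit.
Unset Printing Implicit Defensive.
Import Order.TTheory GRing.Theory Num.Theory.
Local Open Scope ring_scope.

(** * Bit strings under bit flips and controlled flips *)

Section BitStrings.
Variable n : nat.
Implicit Types a b : bits n.

Lemma bitP a b : (forall j, (j < n)%N -> bit a j = bit b j) -> a = b.
Proof.
move=> h; apply: eq_from_tnth => i.
by rewrite !(tnth_nth false); apply: h.
Qed.

Lemma bit_ge a j : (n <= j)%N -> bit a j = false.
Proof. by move=> h; rewrite /bit nth_default // size_tuple. Qed.

Lemma bit_tuple (f : 'I_n -> bool) (i : 'I_n) : bit [tuple f i | i < n] i = f i.
Proof. by rewrite /bit -tnth_nth tnth_mktuple. Qed.

Lemma bit_flip j a k : (j < n)%N -> bit (flipb j a) k = bit a k (+) (k == j).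
Proof.
move=> hj; case: (ltnP k n) => hk; last first.
  by rewrite !bit_ge //; case: eqP => // e; move: hk; rewrite e leqNgt hj.
rewrite /flipb (bit_tuple (fun i => if (i : nat) == j then _ else _) (Ordinal hk)) /=.
rewrite (tnth_nth false) /= -/(bit a k).
by case: (k == j); rewrite ?addbT ?addbF.
Qed.

Lemma flip_ge j a : (n <= j)%N -> flipb j a = a.
Proof.
move=> hj; apply: eq_from_tnth => i; rewrite tnth_mktuple ifN //.
by apply: contraTneq (ltn_ord i) => ->; rewrite -leqNgt.
Qed.

Lemma flipK j : involutive (@flipb n j).
Proof.
move=> a; case: (ltnP j n) => hj; last by rewrite !flip_ge.
by apply: bitP => k _; rewrite !bit_flip // -addbA addbb addbF.
Qed.

Lemma flipC j k a : flipb j (flipb k a) = flipb k (flipb j a).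
Proof.
case: (ltnP j n) => hj; last by rewrite !(flip_ge _ hj).
case: (ltnP k n) => hk; last by rewrite !(flip_ge _ hk).
by apply: bitP => i _; rewrite !bit_flip // addbAC.
Qed.

Lemma flip_neq j a : (j < n)%N -> (a == flipb j a) = false.
Proof.
move=> hj; apply/eqP => e.
by have := bit_flip a j hj; rewrite -e eqxx; case: (bit a j).
Qed.

Definition cflip (c t : nat) a := if bit a c then flipb t a else a.

Lemma bit_cflip c t a k : (t < n)%N ->
  bit (cflip c t a) k = bit a k (+) (bit a c && (k == t)).
Proof.
by move=> ht; rewrite /cflip; case: (bit a c); rewrite ?bit_flip ?addbF.
Qed.

Lemma cflipK c t : (t < n)%N -> c != t -> involutive (cflip c t).
Proof.
move=> ht ct a; apply: bitP => k _; rewrite !bit_cflip // (negbTE ct) andbF addbF.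
by rewrite -addbA addbb addbF.
Qed.

Definition flips (l : seq nat) a := foldr (@flipb n) a l.

Lemma bit_flips l a k : all (fun j => j < n)%N l ->
  bit (flips l a) k = bit a k (+) odd (count_mem k l).
Proof.
elim: l => [|j l IH] /=; first by rewrite addbF.
case/andP=> hj hl; rewrite bit_flip // IH // oddD eq_sym oddb.
by rewrite -addbA [odd _ (+) _]addbC.
Qed.

(** Flip exactly the positions where the strings differ; that list has no repetition, so the parity
    in [bit_flips] becomes membership. *)
Lemma flips_connected a b : exists l, flips l a = b.
Proof.
pose l := [seq j <- iota 0 n | bit a j != bit b j].
exists l; apply: bitP => k hk; rewrite bit_flips; last first.
  by apply/allP => j; rewrite mem_filter mem_iota => /andP[].
rewrite count_uniq_mem ?filter_uniq ?iota_uniq // oddb mem_filter mem_iota hk.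
by rewrite andbT; case: (bit a k); case: (bit b k).
Qed.

Lemma flips_inj l : injective (flips l).
Proof.
elim: l => [|j l IH] a b //= /(inv_inj (@flipK j)); exact: IH.
Qed.

End BitStrings.

(** * Pauli operators and their conjugation by Clifford gates *)

Section Pauli.
Variable R : realType.
Local Notation C := (R[i]).
Local Notation i_ := (Complex 0 1 : C).
Variable n : nat.
Implicit Types (u v : vec R n) (a b : bits n).

Definition ip u v : C := \sum_b conjc (u b) * v b.
Definition scalev (s : C) v : vec R n := fun b => s * v b.
Definition opX j v : vec R n := fun b => v (flipb j b).
Definition opZ j v : vec R n := fun b => (-1) ^+ bit b j * v b.

(** The Pauli group as maps on vectors; [pauli_i] supplies the phases that conjugation by [Sgate]
    creates. An index [j >= n] is harmless, since [opX j] and [opZ j] are then the identity. *)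
Inductive pauli : (vec R n -> vec R n) -> Prop :=
  | pauli_id : pauli id
  | pauli_X j T : pauli T -> pauli (opX j \o T)
  | pauli_Z j T : pauli T -> pauli (opZ j \o T)
  | pauli_i T : pauli T -> pauli (scalev i_ \o T).

Lemma opapp_delta (G : op R n) (f : bits n -> bits n) (w : bits n -> C) v :
  (forall a b, G a b = (b == f a)%:R * w a) ->
  opapp G v = fun a => w a * v (f a).
Proof.
move=> h; apply/funext => a; rewrite /opapp (bigD1 (f a)) //= big1 ?addr0.
  by rewrite h eqxx mul1r.
by move=> b /negbTE hb; rewrite h hb !mul0r.
Qed.

Lemma opapp_S j v :
  opapp (Sgate R j) v = fun b => (if bit b j then i_ else 1) * v b.
Proof.
apply: (opapp_delta (f := id)) => a b.
by rewrite /Sgate eq_sym; case: eqP => [->|]; rewrite // !mul0r.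
Qed.

Lemma opapp_CNOT c t v : (t < n)%N -> c != t ->
  opapp (CNOT R c t) v = fun b => v (cflip c t b).
Proof.
move=> ht ct; rewrite (opapp_delta (f := cflip c t) (w := fun=> 1)).
  by apply/funext => b; rewrite mul1r.
move=> a b; rewrite mulr1 /CNOT -/(cflip c t b) eq_sym.
by rewrite (can2_eq (cflipK ht ct) (cflipK ht ct)).
Qed.

Lemma opapp_H j v : (j < n)%N ->
  opapp (Hgate R j) v =
  fun b => (opZ j v b + opX j v b) / rc (Num.sqrt 2).
Proof.
move=> hj; apply/funext => a; rewrite /opapp (bigD1 a) //= (bigD1 (flipb j a)) /=;
  last first.
  by rewrite eq_sym flip_neq.
rewrite big1 ?addr0; last first.
  move=> b /andP[h1 h2]; rewrite /Hgate.
  have -> : (a == flipb j b) = false.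
    apply/eqP => e; move: h2; rewrite e flipK eqxx //.
  by rewrite eq_sym (negbTE h1) !mul0r.
rewrite /Hgate eqxx flipK eqxx orbT /opZ /opX andbb bit_flip // eqxx addbT.
rewrite andbN /=; case: (bit a j) => /=; ring.
Qed.

Lemma ip_scale s u v : ip u (scalev s v) = s * ip u v.
Proof. by rewrite /ip mulr_sumr; apply: eq_bigr => b _; rewrite mulrCA. Qed.

Lemma sum_flip j (F : bits n -> C) : \sum_b F b = \sum_b F (flipb j b).
Proof. exact: reindex_inj (inv_inj (@flipK n j)). Qed.

Lemma sqrt2_sqr : rc (Num.sqrt (2 : R)) * rc (Num.sqrt 2) = 2.
Proof.
by rewrite -[_ * _](rmorphM (real_complex R)) -expr2 sqr_sqrtr // rmorph_nat.
Qed.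

Lemma sqrt2_neq0 : rc (Num.sqrt (2 : R)) != 0.
Proof.
apply/eqP => e; have := sqrt2_sqr; rewrite e mul0r => /eqP.
by rewrite eq_sym pnatr_eq0.
Qed.

Lemma conjc_rc (x : R) : conjc (rc x) = rc x.
Proof. exact: conjc_real. Qed.

Lemma conjcM (x y : C) : conjc (x * y) = conjc x * conjc y.
Proof. exact: rmorphM. Qed.

Lemma conjcD (x y : C) : conjc (x + y) = conjc x + conjc y.
Proof. exact: rmorphD. Qed.

Lemma conjc_sign (b : bool) : conjc ((-1) ^+ b : C) = (-1) ^+ b.
Proof. by rewrite rmorph_sign. Qed.

(** Unitarity of the gates: [Sgate] multiplies amplitudes by phases, [CNOT] permutes them, and only
    [Hgate] needs a computation. *)
Lemma ip_gen (G : op R n) u v : clifford_gen G ->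
  ip (opapp G u) (opapp G v) = ip u v.
Proof.
case=> [[j [hj ->]]|[[j [hj ->]]|[c [t [hc ht ct ->]]]]].
- rewrite !opapp_H //.
  (* The first two of the four terms each sum to half of [ip u v]; the two cross terms cancel,
     because [flipb j] exchanges them and reverses the sign. *)
  have e b : conjc ((opZ j u b + opX j u b) / rc (Num.sqrt 2)) *
      ((opZ j v b + opX j v b) / rc (Num.sqrt 2)) =
      (conjc (u b) * v b) / 2 + (conjc (opX j u b) * opX j v b) / 2 +
      (conjc (u b) * (-1) ^+ bit b j * v (flipb j b)) / 2 +
      (conjc (u (flipb j b)) * (-1) ^+ bit b j * v b) / 2.
    rewrite conjcM conjcD conjc_inv conjc_rc /opZ conjcM conjc_sign -[in RHS]sqrt2_sqr.
    have := signrMK (bit b j) (1 : C); rewrite mulr1 /opX => ss.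
    transitivity (((-1) ^+ bit b j * ((-1) ^+ bit b j) * conjc (u b) * v b +
      conjc (u (flipb j b)) * v (flipb j b) +
      (-1) ^+ bit b j * (conjc (u b) * v (flipb j b) + conjc (u (flipb j b)) * v b)) /
      (rc (Num.sqrt 2) * rc (Num.sqrt 2))).
      by have := sqrt2_neq0 => q0; field.
    by rewrite ss mul1r; have := sqrt2_neq0 => q0; field.
  rewrite /ip (eq_bigr _ (fun b _ => e b)) !big_split /=.
  rewrite -!mulr_suml /opX -(sum_flip j (fun b => conjc (u b) * v b)).
  have -> : \sum_b conjc (u (flipb j b)) * (-1) ^+ bit b j * v b =
      - \sum_b conjc (u b) * (-1) ^+ bit b j * v (flipb j b).
    rewrite (sum_flip j) -sumrN; apply: eq_bigr => b _.
    by rewrite flipK bit_flip // eqxx addbT signrN mulrN mulNr.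
  by rewrite mulNr addrK -splitr.
- rewrite !opapp_S; apply: eq_bigr => b _; rewrite conjcM mulrACA.
  case: (bit b j); last by rewrite conjc1 !mul1r.
  suff -> : conjc i_ * i_ = 1 by rewrite mul1r.
  by apply/eqP; rewrite eq_complex /=; apply/andP; split; apply/eqP; ring.
- rewrite !opapp_CNOT // /ip.
  by rewrite [RHS](reindex_inj (inv_inj (cflipK ht ct))).
Qed.

(** Clifford gates normalize the Pauli group, checked on generators: [Hgate] swaps X and Z on its
    qubit, [Sgate] turns X into [i Z X], and [CNOT] copies X from control to target and Z from
    target to control. All other generators commute with the gate. *)
Lemma pauli_conj (G : op R n) T : clifford_gen G -> pauli T ->
  exists2 T', pauli T' & forall v, T (opapp G v) = opapp G (T' v).
Proof.
move=> hG; elim=> {T} [|k T _ [T' hT' e]|k T _ [T' hT' e]|T _ [T' hT' e]].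
- by exists id => //; constructor.
- case: hG e => [[j [hj ->]]|[[j [hj ->]]|[c [t [hc ht ct ->]]]]] e.
  + have [kj|kj] := eqVneq k j.
      exists (opZ j \o T'); first exact: pauli_Z.
      move=> v /=; rewrite e kj !opapp_H //; apply/funext => b.
      rewrite /opX /opZ flipK bit_flip // eqxx addbT.
      by case: (bit b j) => /=; rewrite ?expr0 ?expr1; ring.
    exists (opX k \o T'); first exact: pauli_X.
    move=> v /=; rewrite e !opapp_H //; apply/funext => b.
    rewrite /opX /opZ (flipC k j); case: (ltnP k n) => hk;
      last by rewrite !(flip_ge _ hk).
    by rewrite bit_flip // [j == k]eq_sym (negbTE kj) addbF.
  + have [kj|kj] := eqVneq k j.
      exists (scalev i_ \o (opZ j \o (opX j \o T'))).
        by apply: pauli_i; apply: pauli_Z; apply: pauli_X.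
      move=> v /=; rewrite e kj !opapp_S; apply/funext => b.
      rewrite /opX /scalev /opZ bit_flip // eqxx addbT.
      case: (bit b j) => /=; rewrite ?expr0 ?expr1; last by ring.
      have := sqr_i R; rewrite expr2 => h; transitivity (- (i_ * i_) * T' v (flipb j
        b)); last by ring.
      by rewrite h opprK.
    exists (opX k \o T'); first exact: pauli_X.
    move=> v /=; rewrite e !opapp_S; apply/funext => b.
    rewrite /opX; case: (ltnP k n) => hk; last by rewrite !(flip_ge _ hk).
    by rewrite bit_flip // [j == k]eq_sym (negbTE kj) addbF.
  + have [kc|kc] := eqVneq k c.
      exists (opX c \o (opX t \o T')); first by apply: pauli_X; apply: pauli_X.
      move=> v /=; rewrite e kc !opapp_CNOT //; apply/funext => b.
      rewrite /opX /cflip bit_flip // eqxx addbT.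
      by case: (bit b c); rewrite /= ?(flipC t c) ?flipK.
    exists (opX k \o T'); first exact: pauli_X.
    move=> v /=; rewrite e !opapp_CNOT //; apply/funext => b.
    rewrite /opX /cflip; case: (ltnP k n) => hk; last by rewrite !(flip_ge _ hk).
    rewrite bit_flip // [c == k]eq_sym (negbTE kc) addbF.
    by case: (bit b c); rewrite // flipC.
- case: hG e => [[j [hj ->]]|[[j [hj ->]]|[c [t [hc ht ct ->]]]]] e.
  + have [kj|kj] := eqVneq k j.
      exists (opX j \o T'); first exact: pauli_X.
      move=> v /=; rewrite e kj !opapp_H //; apply/funext => b.
      rewrite /opX /opZ flipK.
      by case: (bit b j) => /=; rewrite ?expr0 ?expr1; ring.
    exists (opZ k \o T'); first exact: pauli_Z.
    move=> v /=; rewrite e !opapp_H //; apply/funext => b.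
    rewrite /opX /opZ bit_flip // (negbTE kj) addbF; ring.
  + exists (opZ k \o T'); first exact: pauli_Z.
    by move=> v /=; rewrite e !opapp_S; apply/funext => b; rewrite /opZ mulrCA.
  + have [kt|kt] := eqVneq k t.
      exists (opZ c \o (opZ t \o T')); first by apply: pauli_Z; apply: pauli_Z.
      move=> v /=; rewrite e kt !opapp_CNOT //; apply/funext => b.
      rewrite /opZ !bit_cflip // (negbTE ct) eqxx andbF andbT addbF signr_addb.
      by rewrite mulrA [_ * (_ * _)]mulrCA -expr2 sqrr_sign mulr1.
    exists (opZ k \o T'); first exact: pauli_Z.
    move=> v /=; rewrite e !opapp_CNOT //; apply/funext => b.
    by rewrite /opZ bit_cflip // (negbTE kt) andbF addbF.
- exists (scalev i_ \o T'); first exact: pauli_i.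
  move=> v /=; rewrite e; apply/funext => b.
  by rewrite /scalev /opapp mulr_sumr; apply: eq_bigr => c _; rewrite mulrCA.
Qed.

Lemma opapp_scale (G : op R n) s v : opapp G (scalev s v) = scalev s (opapp G v).
Proof.
by apply/funext => b; rewrite /scalev /opapp mulr_sumr; apply: eq_bigr => c _;
  rewrite mulrCA.
Qed.

Lemma sign_i (b : bool) : ((-1) ^+ b : C) = i_ ^+ (b.*2).
Proof. by rewrite -mul2n exprM sqr_i. Qed.

Lemma pauli_ket0 T : pauli T ->
  exists k l, T (@ket0 R n) = scalev (i_ ^+ k) (fun b => @ket0 R n (flips l b)).
Proof.
elim=> {T} [|j T _ [k [l e]]|j T _ [k [l e]]|T _ [k [l e]]] /=.
- by exists 0%N, [::]; apply/funext => b; rewrite /scalev mul1r.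
- exists k, (rcons l j); rewrite e; apply/funext => b.
  by rewrite /scalev /opX /flips foldr_rcons.
(* The vector is supported on the single string [b0], so [opZ] acts on it by one constant sign. *)
- have [b0 hb0] : exists b0 : bits n, flips l b0 = [tuple of nseq n false].
    have [f _ fK] : bijective (@flips n l) by apply: injF_bij; exact: flips_inj.
    by exists (f [tuple of nseq n false]); rewrite fK.
  exists ((bit b0 j).*2 + k)%N, l; rewrite e; apply/funext => b.
  rewrite /opZ /scalev exprD -sign_i mulrA /ket0.
  have [h|_] := eqVneq (flips l b) _; last by rewrite !mulr0.
  by rewrite (@flips_inj _ l b b0) // h hb0.
- by exists k.+1, l; rewrite e; apply/funext => b; rewrite /scalev mulrA -exprS.
Qed.

(** A Pauli operator maps [ket0] to a basis vector with a phase, which is either [ket0] again or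
    orthogonal to it. Both alternatives pass through a gate by [pauli_conj], the second using
    unitarity. *)
Lemma stab_pauli v T : stab_vec v -> pauli T ->
  (exists k, T v = scalev (i_ ^+ k) v) \/ ip v (T v) = 0.
Proof.
move=> hv; elim: hv T => {v} [|G v hG _ IH] T hT.
  have [k [l e]] := pauli_ket0 hT; rewrite e.
  have [h|h] := eqVneq (flips l [tuple of nseq n false]) [tuple of nseq n false].
    left; exists k; apply/funext => b; rewrite /scalev /ket0.
    by rewrite -{1}h (inj_eq (@flips_inj _ l)).
  right; rewrite ip_scale /ip big1 ?mulr0 // => b _; rewrite /ket0.
  have [->|_] := eqVneq b; last by rewrite conjc0 mul0r.
  by rewrite (negbTE h) mulr0.
have [T' hT' e] := pauli_conj hG hT; rewrite e.
have [[k ->]|h] := IH T' hT'; first by left; exists k; rewrite opapp_scale.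
by right; rewrite ip_gen.
Qed.

(** * Characters of bit strings and relative phases of stabilizer amplitudes *)

Definition sgn (l : seq nat) (b : bits n) : C := \prod_(j <- l) (-1) ^+ bit b j.

(* Fourier inversion on bit strings. *)
Lemma sgn_separate (f : bits n -> C) a :
  (forall l, \sum_b f b * sgn l b = 0) -> f a = 0.
Proof.
move=> h.
(* The bits are pinned to those of [a] one at a time: the indicator of agreement at [m] is half of
   [1 + (-1)^(a_m + b_m)], which gives two sums of the same form, one with [m] added to the
   character. *)
have H m l : (m <= n)%N ->
    \sum_b f b * sgn l b * \prod_(0 <= j < m) (bit b j == bit a j)%:R = 0.
  elim: m l => [|m IH] l hm.
    by rewrite -[RHS](h l); apply: eq_bigr => b _; rewrite big_geq // mulr1.
  have e b : f b * sgn l b * \prod_(0 <= j < m.+1) (bit b j == bit a j)%:R =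
     1 / 2 * (f b * sgn l b * \prod_(0 <= j < m) (bit b j == bit a j)%:R) +
     (-1) ^+ bit a m / 2 *
       (f b * sgn (m :: l) b * \prod_(0 <= j < m) (bit b j == bit a j)%:R).
    rewrite big_nat_recr //= /sgn big_cons.
    by case: (bit a m); case: (bit b m) => /=; rewrite ?expr0 ?expr1; field.
  by rewrite (eq_bigr _ (fun b _ => e b)) big_split /= -!mulr_sumr !IH ?(ltnW hm) //
    !mulr0 addr0.
have := H n [::] (leqnn n); rewrite (bigD1 a) //= [X in _ + X]big1 => [|b hb].
  rewrite addr0 /sgn big_nil mulr1 big1 ?mulr1 // => j _; rewrite eqxx //.
have [|/allPn [j]] := boolP (all (fun j => bit b j == bit a j) (index_iota 0 n)).
  move/allP => hall; case/eqP: hb; apply: bitP => j hj.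
  by apply/eqP/hall; rewrite mem_index_iota.
by move=> hj /negbTE hne; rewrite (big_rem j) //= hne mul0r mulr0.
Qed.

Lemma pauli_word l1 l2 : pauli (fun v b => sgn l1 b * v (flips l2 b)).
Proof.
elim: l1 => [|j l1 IH]; last first.
  move: (pauli_Z j IH); congr pauli; apply/funext => v; apply/funext => b /=.
  by rewrite /opZ /sgn big_cons mulrA.
elim/last_ind: l2 => [|l2 j IH].
  move: pauli_id; congr pauli; apply/funext => v; apply/funext => b.
  by rewrite /sgn big_nil mul1r.
move: (pauli_X j IH); congr pauli; apply/funext => v; apply/funext => b /=.
by rewrite /opX /sgn !big_nil /flips foldr_rcons.
Qed.

Lemma sgn_i l b : exists k, sgn l b = i_ ^+ k.
Proof.
elim: l => [|j l [k e]]; first by exists 0%N; rewrite /sgn big_nil.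
by exists ((bit b j).*2 + k)%N; rewrite /sgn big_cons -/(sgn l b) e sign_i exprD.
Qed.

(* By Fourier inversion some Pauli operator moving [a] to [b] has nonzero
   expectation in [v], hence fixes [v] up to a phase. *)
Lemma stab_phase v a b : stab_vec v -> v a != 0 -> v b != 0 ->
  exists k, v b = i_ ^+ k * v a.
Proof.
move=> hv ha hb; apply: contrapT => hno.
have [l hl] := flips_connected a b.
suff : conjc (v a) * v b = 0.
  by apply/eqP; rewrite mulf_eq0 conjc_eq0 (negbTE ha) (negbTE hb).
rewrite -hl; apply: (@sgn_separate (fun x => conjc (v x) * v (flips l x))) => l1.
have [[k e]|e] := stab_pauli hv (pauli_word l1 l).
  case: hno; have := congr1 (fun w => w a) e; rewrite /scalev hl.
  have [m ->] := sgn_i l1 a => h.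
  (* The inverse of [i^m] is [i^(3 m)], since the fourth power of [i] is 1. *)
  exists (m * 3 + k)%N; rewrite exprD -mulrA -h mulrA -exprD -mulnSr mulnC exprM.
  by rewrite -[4%N]/(2 * 2)%N exprM sqr_i sqrrN !expr1n mul1r.
by rewrite -[RHS]e; apply: eq_bigr => x _; rewrite mulrAC -mulrA.
Qed.

End Pauli.

(** * Code words of the repetition code *)

Definition rep n (c : bool) : bits n := [tuple of nseq n c].

Lemma bit_rep n c j : (j < n)%N -> bit (rep n c) j = c.
Proof. by move=> hj; rewrite /bit /= nth_nseq hj. Qed.

Definition is_rep n (b : bits n) := b == rep n (bit b 0).

Lemma is_rep_rep n c : (0 < n)%N -> is_rep (rep n c).
Proof. by move=> hn; rewrite /is_rep bit_rep. Qed.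

Lemma rep_eq n c c' : (0 < n)%N -> (rep n c == rep n c') = (c == c').
Proof.
move=> hn; apply/eqP/eqP => [e|-> //].
by have := congr1 (fun b => bit b 0) e; rewrite !bit_rep.
Qed.

Lemma sum_rep (V : nmodType) n (F : bits n -> V) : (0 < n)%N ->
  \sum_(b | is_rep b) F b = F (rep n false) + F (rep n true).
Proof.
move=> hn; rewrite (bigD1 (rep n false)) ?is_rep_rep //=.
rewrite (bigD1 (rep n true)) /=; last by rewrite is_rep_rep // rep_eq.
rewrite big1 ?addr0 // => b /andP[/andP[/eqP ->]]; rewrite !rep_eq //.
by case: (bit b 0).
Qed.

Lemma bits1E (b : bits 1) : b = [tuple bit b 0].
Proof. by apply: bitP => -[]. Qed.

Lemma is_rep1 (b : bits 1) : is_rep b.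
Proof. by rewrite /is_rep [X in X == _]bits1E; apply/eqP/bitP => -[|j] //= _;
  rewrite bit_rep. Qed.

Lemma sum_bits1 (V : nmodType) (F : bits 1 -> V) :
  \sum_b F b = F [tuple false] + F [tuple true].
Proof.
have e c : [tuple c] = rep 1 c by rewrite [RHS]bits1E bit_rep.
by rewrite !e -sum_rep //; apply: eq_bigl => b; rewrite is_rep1.
Qed.

(** * Stabilizer states, their mixtures and their blocks on the code *)

Section Stabilizers.
Variable R : realType.
Local Notation C := (R[i]).
Local Notation i_ := (Complex 0 1 : C).

Lemma rcM (x y : R) : rc (x * y) = rc x * rc y.
Proof. exact: rmorphM. Qed.

Lemma rcD (x y : R) : rc (x + y) = rc x + rc y.
Proof. exact: rmorphD. Qed.

Lemma rc0 : rc (0 : R) = 0.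
Proof. exact: rmorph0. Qed.

Lemma rc1 : rc (1 : R) = 1.
Proof. exact: rmorph1. Qed.

Lemma rcN (x : R) : rc (- x) = - rc x.
Proof. exact: rmorphN. Qed.

Lemma rcV (x : R) : rc x^-1 = (rc x)^-1.
Proof. exact: fmorphV. Qed.

Lemma rc_nat n : rc (n%:R : R) = n%:R.
Proof. exact: rmorph_nat. Qed.

Lemma rc_sum I (r : seq I) (F : I -> R) :
  rc (\sum_(j <- r) F j) = \sum_(j <- r) rc (F j).
Proof. exact: rmorph_sum. Qed.

Lemma rc_le (x y : R) : (rc x <= rc y) = (x <= y).
Proof. exact: lecR. Qed.

Lemma stab_norm n (v : vec R n) : stab_vec v -> ip v v = 1.
Proof.
elim=> {v} [|G v hG _ IH]; last by rewrite ip_gen.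
rewrite /ip (bigD1 [tuple of nseq n false]) //= big1; last first.
  by move=> b /negbTE hb; rewrite /ket0 hb mulr0.
by rewrite /ket0 eqxx conjc1 mulr1 addr0.
Qed.

(** X is the Clifford circuit [H S S H], because [S S] is Z. *)
Lemma stab_X n j (v : vec R n) : stab_vec v -> stab_vec (opX j v).
Proof.
move=> hv; case: (ltnP j n) => hj; last first.
  suff -> : opX j v = v by [].
  by apply/funext => b; rewrite /opX flip_ge.
have hH : clifford_gen (@Hgate R n j) by left; exists j.
have hS : clifford_gen (@Sgate R n j) by right; left; exists j.
suff <- : opapp (Hgate R j) (opapp (Sgate R j) (opapp (Sgate R j)
    (opapp (Hgate R j) v))) = opX j v by do 4!apply: stab_vec_step => //.
rewrite !opapp_S (opapp_H _ hj) (opapp_H v hj); apply/funext => b.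
rewrite /opX /opZ !bit_flip // eqxx addbT flipK.
have q0 := @sqrt2_neq0 R; have q2 := @sqrt2_sqr R.
have i2 := sqr_i R; rewrite expr2 in i2.
transitivity (2 * v (flipb j b) / (rc (Num.sqrt 2) * rc (Num.sqrt 2))); last first.
  by rewrite q2 mulrAC divff ?mul1r // pnatr_eq0.
by case: (bit b j) => /=; rewrite ?expr0 ?expr1 !(mulrA i_) i2; field.
Qed.

Definition ket n (b : bits n) : vec R n := fun x => (x == b)%:R.

Lemma stab_ket n (b : bits n) : stab_vec (ket b).
Proof.
have [l hl] := flips_connected b (rep n false).
suff h : forall l, stab_vec (fun x => @ket0 R n (flips l x)).
  move: (h l); congr stab_vec; apply/funext => x.
  by rewrite /ket /ket0 -/(rep n false) -hl (inj_eq (@flips_inj _ l)).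
move=> l1; elim/last_ind: l1 => [|l1 j IH]; first exact: stab_vec0.
move: (stab_X j IH); congr stab_vec; apply/funext => x.
by rewrite /opX /flips foldr_rcons.
Qed.

(** The four equatorial one-qubit stabilizer states, indexed by [k] modulo 4. *)
Definition ket_plus (k : nat) : vec R 1 :=
  fun x => (if bit x 0 then i_ ^+ k else 1) / rc (Num.sqrt 2).

Lemma stab_plus k : stab_vec (ket_plus k).
Proof.
elim: k => [|k IH].
  suff <- : opapp (Hgate R 0) (@ket0 R 1) = ket_plus 0.
    by apply: stab_vec_step; [left; exists 0%N | exact: stab_vec0].
  rewrite opapp_H //; apply/funext => x; rewrite /opZ /opX /ket0 /ket_plus expr0 if_same.
  congr (_ / _); have e (y : bits 1) : (y == [tuple of nseq 1 false]) = ~~ bit y 0.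
    apply/eqP/idP => [->|]; first by rewrite bit_rep.
    by move=> h; apply: bitP => -[|//] _; rewrite bit_rep // (negbTE h).
  by rewrite !e bit_flip // addbT; case: (bit x 0);
    rewrite /= ?expr0 ?mulr1 ?mulr0 ?addr0 ?add0r.
suff <- : opapp (Sgate R 0) (ket_plus k) = ket_plus k.+1.
  by apply: stab_vec_step => //; right; left; exists 0%N.
rewrite opapp_S; apply/funext => x; rewrite /ket_plus exprS.
by case: (bit x 0); rewrite ?mulrA ?mul1r.
Qed.

(** Weights may be negative, and the index type is an arbitrary finite type so that sum types can
    label the terms of a decomposition. *)
Definition mix n (T : finType) (q : T -> R) (s : T -> op R n) : op R n :=
  fun a b => \sum_j rc (q j) * s j a b.

Lemma sum_enum_val (V : nmodType) (T : finType) (F : T -> V) :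
  \sum_j F j = \sum_(i < #|T|) F (enum_val i).
Proof. by rewrite (reindex_onto enum_val enum_rank) /= => [|j _];
  rewrite ?enum_rankK //; apply: eq_bigl => i; rewrite enum_valK eqxx. Qed.

Lemma in_stab_poly_mix n (T : finType) (p : T -> R) (v : T -> vec R n) :
  (forall j, 0 <= p j) -> \sum_j p j = 1 -> (forall j, stab_vec (v j)) ->
  in_stab_poly (mix p (fun j => proj (v j))).
Proof.
move=> h0 h1 hv; exists #|T|, (p \o enum_val), (v \o enum_val); split => //=.
- by rewrite -(sum_enum_val p).
- by apply/funext => a; apply/funext => b; rewrite /mix [LHS]sum_enum_val.
Qed.

Lemma in_stab_poly_proj n (v : vec R n) : stab_vec v -> in_stab_poly (proj v).
Proof.
move=> hv; have := @in_stab_poly_mix n unit (fun=> 1) (fun=> v).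
have -> : mix (fun _ : unit => 1) (fun=> proj v) = proj v.
  apply/funext => a; apply/funext => b.
  by rewrite /mix big_const card_unit /= addr0 rc1 mul1r.
by apply => //; rewrite ?ler01 // big_const card_unit /= addr0.
Qed.

Lemma trace_stab n (s : op R n) : in_stab_poly s -> trace s = 1.
Proof.
case=> k [p [v [hp h1 hv ->]]]; rewrite /trace exchange_big /=.
rewrite -rc1 -h1 rc_sum; apply: eq_bigr => j _.
rewrite -mulr_sumr -[RHS]mulr1; congr (_ * _).
by rewrite -(stab_norm (hv j)); apply: eq_bigr => b _; rewrite mulrC.
Qed.

(* Decoding the repetition code: the block of [s] on the span of [|0..0>] and
   [|1..1>], read as a one-qubit operator. *)
Definition restr n (s : op R n) : op R 1 :=
  fun a b => s (rep n (bit a 0)) (rep n (bit b 0)).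

Lemma normsq_rc (x : C) : x * conjc x = rc ((complex.Re x) ^+ 2 + (complex.Im x) ^+ 2).
Proof. by rewrite [RHS]add_Re2_Im2 sqr_normc. Qed.

(** If one of the two amplitudes on code words vanishes, the block is a multiple of a basis
    projector. Otherwise [stab_phase] makes their ratio a power [i^k], and the block is a multiple
    of the projector on [ket_plus k]. The factor is the squared norm of the code part of a unit
    vector, hence at most 1. *)
Lemma restr_stab_vec n (v : vec R n) : (0 < n)%N -> stab_vec v ->
  exists m u, [/\ 0 <= m <= 1, stab_vec u &
    restr (proj v) = (fun a b => rc m * proj u a b)].
Proof.
move=> hn hv; set x := v (rep n false); set y := v (rep n true).
pose nx := (complex.Re x) ^+ 2 + (complex.Im x) ^+ 2;
  pose ny := (complex.Re y) ^+ 2 + (complex.Im y) ^+ 2.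
have hnx : 0 <= nx by rewrite addr_ge0 ?sqr_ge0.
have hny : 0 <= ny by rewrite addr_ge0 ?sqr_ge0.
have hm : nx + ny <= 1.
  rewrite -rc_le rc1 -(stab_norm hv) rcD -!normsq_rc.
  rewrite -(sum_rep (fun b => v b * conjc (v b))) //.
  rewrite /ip [leRHS](bigID (@is_rep n)) /=.
  under [X in _ <= X + _]eq_bigr do rewrite mulrC.
  by rewrite lerDl sumr_ge0 // => b _; rewrite mulrC mulcJ_ge0.
have restrE : restr (proj v) = fun a b => (if bit a 0 then y else x) * (if bit b 0 then
  conjc y else conjc x).
  by apply/funext => a; apply/funext => b; rewrite /restr /proj; case: (bit a 0);
    case: (bit b 0).
have k1 (a : bits 1) c : (a == rep 1 c) = (bit a 0 == c).
  by apply/eqP/eqP => [->|<-]; [rewrite bit_rep | apply/eqP; exact: is_rep1].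
have [x0|x0] := eqVneq x 0.
  exists ny, (ket (rep 1 true)); split; [by rewrite hny /= (le_trans _ hm) // lerDr |
    exact: stab_ket | ].
  rewrite restrE x0 conjc0; apply/funext => a; apply/funext => b;
    rewrite /proj /ket !k1 conjc_nat -normsq_rc.
    by case: (bit a 0); case: (bit b 0); rewrite /= ?mulr0 ?mul0r ?mulr1 ?mulr0.
have [y0|y0] := eqVneq y 0.
  exists nx, (ket (rep 1 false)); split; [by rewrite hnx /= (le_trans _ hm) // lerDl |
    exact: stab_ket | ].
  rewrite restrE y0 conjc0; apply/funext => a; apply/funext => b;
    rewrite /proj /ket !k1 conjc_nat -normsq_rc.
  by case: (bit a 0); case: (bit b 0); rewrite /= ?mulr0 ?mul0r ?mulr1 ?mulr0.
have [k] := stab_phase hv x0 y0; rewrite -/x -/y => e.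
exists (nx + ny), (ket_plus k); split; [by rewrite hm addr_ge0 | exact: stab_plus | ].
have ii : i_ ^+ k * conjc (i_ ^+ k) = 1.
  rewrite [conjc _]rmorphXn -exprMn; suff -> : i_ * conjc i_ = 1 by rewrite expr1n.
  by apply/eqP; rewrite eq_complex /=; apply/andP; split; apply/eqP; ring.
have q0 := @sqrt2_neq0 R; have q2 := @sqrt2_sqr R.
have -> : rc (nx + ny) = 2 * (x * conjc x).
  rewrite rcD -!normsq_rc e conjcM mulrACA ii.
  by rewrite mul1r -mulr2n mulr_natl.
rewrite restrE e; apply/funext => a; apply/funext => b; rewrite /proj /ket_plus.
pose f (c : bits 1) := if bit c 0 then i_ ^+ k else 1.
have -> : (if bit a 0 then i_ ^+ k * x else x) = f a * x by rewrite /f; case: ifP;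
  rewrite ?mul1r.
have -> : (if bit b 0 then conjc (i_ ^+ k * x) else conjc x) = conjc (f b) * conjc x.
  by rewrite /f; case: ifP; rewrite -conjcM ?mul1r.
by rewrite -q2 -/(f a) -/(f b) conjcM conjc_inv conjc_rc; field.
Qed.

(** The blocks of the pure terms are rescaled: their weights, divided by the total [m], are the new
    convex weights. *)
Lemma restr_stab n (s : op R n) : (0 < n)%N -> in_stab_poly s ->
  exists m t, [/\ 0 <= m <= 1, in_stab_poly t &
    restr s = (fun a b => rc m * t a b)].
Proof.
move=> hn [k [p [v [hp h1 hv ->]]]].
have /fin_all_exists [f hf] : forall j, exists mu : R * vec R 1,
    [/\ 0 <= mu.1 <= 1, stab_vec mu.2 &
    restr (proj (v j)) = (fun a b => rc mu.1 * proj mu.2 a b)].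
  by move=> j; have [m [u H]] := restr_stab_vec hn (hv j); exists (m, u).
pose m := \sum_j p j * (f j).1.
have hpm j : 0 <= p j * (f j).1 by have [/andP[h _] _ _] := hf j; rewrite mulr_ge0.
have hm0 : 0 <= m by apply: sumr_ge0.
have hm1 : m <= 1.
  rewrite -h1; apply: ler_sum => j _; have [/andP[_ h] _ _] := hf j.
  by rewrite ler_piMr.
have E : restr (fun a b => \sum_j rc (p j) * proj (v j) a b) =
    mix (fun j => p j * (f j).1) (fun j => proj (f j).2).
  apply/funext => a; apply/funext => b; rewrite /restr /mix; apply: eq_bigr => j _.
  have [_ _ h] := hf j; have := congr1 (fun w => w a b) h; rewrite /restr => ->.
  by rewrite rcM mulrA.
have [m0|m0] := eqVneq m 0.
  (* A vanishing block leaves [t] undetermined; any stabilizer state serves. *)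
  exists 0, (proj (@ket0 R 1)); split; first by rewrite lexx ler01.
    exact/in_stab_poly_proj/stab_vec0.
  rewrite E; apply/funext => a; apply/funext => b; rewrite rc0 mul0r.
  rewrite /mix big1 // => j _.
  rewrite (psumr_eq0P (fun j _ => hpm j) m0) //.
  by rewrite rc0 mul0r.
exists m, (mix (fun j => p j * (f j).1 / m) (fun j => proj (f j).2)); split.
- by rewrite hm0.
- apply: in_stab_poly_mix => [j||j].
  + by rewrite divr_ge0.
  + by rewrite -mulr_suml divff.
  + by have [] := hf j.
- rewrite E; apply/funext => a; apply/funext => b; rewrite /mix mulr_sumr.
  by apply: eq_bigr => j _; rewrite [RHS]mulrA -rcM [m * _]mulrC divfK.
Qed.

(** By [stab_phase] all nonzero amplitudes share one modulus, so the bound is an equality unless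
    [v b] vanishes and [v a] does not. *)
Lemma stab_dominated n (v : vec R n) a b : stab_vec v ->
  `|v a * conjc (v b)| <= v a * conjc (v a).
Proof.
move=> hv; have [a0|a0] := eqVneq (v a) 0; first by rewrite a0 !mul0r normr0.
have [b0|b0] := eqVneq (v b) 0; first by rewrite b0 conjc0 mulr0 normr0 mulcJ_ge0.
have [k ->] := stab_phase hv a0 b0.
rewrite conjcM mulrCA normrM normcJ normrX.
suff -> : `|i_| = 1 by rewrite expr1n mul1r ger0_norm ?mulcJ_ge0.
by rewrite normc_def /= expr0n add0r expr1n sqrtr1.
Qed.

(** The triangle inequality carries the pure-state bound to mixtures; this is the test that expels a
    large coherence from the polytope. *)
Lemma stab_poly_dominated n (s : op R n) a b (x y : R) : in_stab_poly s ->
  s a b = rc x -> s a a = rc y -> x <= y.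
Proof.
move=> [k [p [v [hp h1 hv ->]]]] hx hy.
suff : `|rc x| <= rc y.
  by rewrite normc_def /= expr0n addr0 sqrtr_sqr lecR; apply: le_trans; exact: ler_norm.
rewrite -hx -hy; apply: le_trans (ler_norm_sum _ _ _) _.
apply: ler_sum => j _; rewrite normrM ger0_norm ?ler0c //.
by apply: ler_wpM2l; [rewrite ler0c | exact: stab_dominated].
Qed.

(** * Encoding one qubit into the repetition code *)

Definition emb n (u : vec R 1) : vec R n :=
  fun b => if is_rep b then u [tuple bit b 0] else 0.

(* [stage m b]: after the CNOTs onto qubits [1 .. m-1], exactly the qubits below
   [m] repeat qubit 0 and the others are 0. *)
Definition stage n m (b : bits n) :=
  all (fun j => bit b j == bit b 0 && (j < m)%N) (iota 1 n.-1).

Definition emb_stage n m (u : vec R 1) : vec R n :=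
  fun b => if stage m b then u [tuple bit b 0] else 0.

(** The one-qubit circuit preparing [u] is replayed on qubit 0 of the register while the other
    qubits stay 0. *)
Lemma emb_stage1_stab n u : (0 < n)%N -> stab_vec u -> stab_vec (@emb_stage n 1 u).
Proof.
move=> hn; have stage1 (b : bits n) : stage 1 b = all (fun j => ~~ bit b j) (iota 1 n.-1).
  apply: eq_in_all => j; rewrite mem_iota => /andP[hj _].
  by rewrite ltnNge hj andbF eqbF_neg.
have stage_flip (b : bits n) : stage 1 (flipb 0 b) = stage 1 b.
  rewrite !stage1; apply: eq_in_all => j; rewrite mem_iota => /andP[hj _].
  by rewrite bit_flip // -[j == _]negbK -lt0n hj addbF.
elim=> {u} [|G u hG _ IH].
  move: (stab_vec0 R n); congr stab_vec; apply/funext => b.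
  rewrite /emb_stage /ket0 stage1.
  have -> : ([tuple bit b 0] == [tuple of nseq 1 false]) = ~~ bit b 0.
    apply/eqP/idP => [e|h].
      by have := congr1 (fun b => bit b 0) e; rewrite bit_rep // /bit /= => ->.
    by apply: bitP => -[|//] _; rewrite bit_rep // (negbTE h).
  case: allP => h; last first.
    suff -> : (b == [tuple of nseq n false]) = false by [].
    apply/eqP => e; case: h => j; rewrite mem_iota add1n prednK // => /andP[_ hj].
    by rewrite e bit_rep.
  congr (_%:R); congr (nat_of_bool _); apply/eqP/idP => [->|h0]; first by rewrite bit_rep.
  apply: bitP => -[|j] hj; rewrite bit_rep //; apply/negbTE => //.
  by apply: h; rewrite mem_iota add1n prednK.
case: hG => [[j [hj ->]]|[[j [hj ->]]|[c [t [hc ht ct _]]]]].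
- move: hj; rewrite ltnS leqn0 => /eqP ->.
  have hG : clifford_gen (Hgate R (n := n) 0) by left; exists 0%N.
  move: (stab_vec_step hG IH); congr stab_vec.
  rewrite !opapp_H //; apply/funext => b; rewrite /emb_stage /opX /opZ stage_flip.
  case: (stage 1 b); last by rewrite mulr0 addr0 mul0r.
  congr ((_ * _ + u _) / _); apply: bitP => -[|//] _.
  by rewrite [RHS]bit_flip //; exact: bit_flip.
- move: hj; rewrite ltnS leqn0 => /eqP ->.
  have hG : clifford_gen (Sgate R (n := n) 0) by right; left; exists 0%N.
  move: (stab_vec_step hG IH); congr stab_vec.
  rewrite !opapp_S; apply/funext => b; rewrite /emb_stage.
  by case: (stage 1 b); rewrite ?mulr0.
(* A CNOT would need two distinct qubits below 1. *)
- by move: hc ht ct; rewrite !ltnS !leqn0 => /eqP -> /eqP ->.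
Qed.

(** Stage 1 precedes every CNOT; the CNOT onto qubit [m.+1] leads from stage [m.+1] to stage [m.+2],
    and stage [n] is the code. *)
Lemma emb_stab n u : (0 < n)%N -> stab_vec u -> stab_vec (@emb n u).
Proof.
move=> hn hu.
suff h m : (m < n)%N -> stab_vec (@emb_stage n m.+1 u).
  move: (h n.-1); rewrite prednK // => /(_ (leqnn n)); congr stab_vec.
  apply/funext => b; rewrite /emb_stage /emb; congr (if _ then _ else _).
  apply/allP/eqP => [h2|e j]; last first.
    rewrite mem_iota add1n prednK // => /andP[_ hj].
    by rewrite hj andbT [X in bit X j]e bit_rep.
  apply: bitP => -[|j] hj; rewrite bit_rep //.
  by have := h2 j.+1; rewrite mem_iota add1n prednK // hj !andbT => /(_ isT)/eqP.
elim: m => [|m IH] hm; first exact: emb_stage1_stab.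
have hG : clifford_gen (CNOT R (n := n) 0 m.+1).
  by right; right; exists 0%N, m.+1.
move: (stab_vec_step hG (IH (ltnW hm))); congr stab_vec.
rewrite opapp_CNOT //; apply/funext => b; rewrite /emb_stage bit_cflip // andbF addbF.
congr (if _ then _ else _); apply: eq_all => j; rewrite !bit_cflip // andbF addbF.
case: (bit b 0) => /=; rewrite ?addbF // ltnS [in RHS]leq_eqVlt eqSS ltnS ltnS.
by case: (eqVneq j m.+1) => [->|_]; rewrite ?ltnn /= ?addbT ?addbF ?eqbF_neg ?negbK
  ?eqb_id.
Qed.

Definition embop n (t : op R 1) : op R n := fun a b =>
  if is_rep a && is_rep b then t [tuple bit a 0] [tuple bit b 0] else 0.

Lemma embop_stab n t : (0 < n)%N -> in_stab_poly t -> in_stab_poly (@embop n t).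
Proof.
move=> hn [k [p [v [hp h1 hv ->]]]].
exists k, p, (fun j => @emb n (v j)); split=> // [j|]; first exact: emb_stab.
apply/funext => a; apply/funext => b; rewrite /embop /proj /emb.
case: (is_rep a) => /=; last by rewrite big1 // => j _; rewrite mul0r mulr0.
by case: (is_rep b) => //; rewrite big1 // => j _; rewrite conjc0 !mulr0.
Qed.

End Stabilizers.

(** * States with a single coherence between the two constant strings *)

Section States.
Variable R : realType.
Local Notation C := (R[i]).

Definition ghz_op n (d : bits n -> R) (c : R) : op R n := fun a b =>
  rc (if a == b then d a else if is_rep a && is_rep b then c else 0).

(** The encoded plus state has all four block entries equal to [1/2]: weight [2 * c] on it produces
    the coherence and uses up [c] of each code-word diagonal entry. *)
Definition ghz_weight n (d : bits n -> R) (c : R) (j : unit + bits n) : R :=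
  match j with
  | inl _ => 2 * c
  | inr b => if is_rep b then d b - c else d b
  end.

Definition ghz_vec n (j : unit + bits n) : vec R n :=
  match j with
  | inl _ => @emb R n (ket_plus R 0)
  | inr b => @ket R n b
  end.

Lemma ghz_vec_stab n j : (0 < n)%N -> stab_vec (@ghz_vec n j).
Proof.
move=> hn; case: j => [u|b]; last exact: stab_ket.
by apply: emb_stab => //; exact: stab_plus.
Qed.

Lemma sum_unit_sum (V : nmodType) n (F : unit + bits n -> V) :
  \sum_j F j = F (inl tt) + \sum_b F (inr b).
Proof. by rewrite big_sumType /= (big_pred1 tt) // => -[]. Qed.

Lemma ghz_opE n d c :
  @ghz_op n d c = mix (ghz_weight d c) (fun j => proj (@ghz_vec n j)).
Proof.
apply/funext => a; apply/funext => b; rewrite /mix sum_unit_sum /=.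
rewrite (bigD1 a) //= big1 ?addr0 => [|x hx]; last first.
  by rewrite /proj /ket eq_sym (negbTE hx) mul0r mulr0.
have q0 := @sqrt2_neq0 R; have q2 := @sqrt2_sqr R.
have -> : proj (@emb R n (ket_plus R 0)) a b =
    (if is_rep a && is_rep b then 1 else 0) / 2.
  rewrite /proj /emb /ket_plus expr0 !if_same.
  case: (is_rep a); last by rewrite /= !mul0r.
  case: (is_rep b); last by rewrite conjc0 mulr0 mul0r.
  by rewrite conjcM conjc_inv conjc1 conjc_rc mulf_div q2 mulr1.
rewrite /proj /ket conjc_nat eqxx mul1r [b == a]eq_sym /ghz_op rcM rc_nat.
have [<-|ab] := eqVneq a b.
  rewrite andbb mulr1; case: (is_rep a); last by rewrite mul0r mulr0 add0r.
  by rewrite rcD rcN; field.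
rewrite mulr0 addr0; case: ifP => _; last by rewrite mul0r mulr0 rc0.
by field.
Qed.

Lemma ghz_weight_sum n (d : bits n -> R) c : (0 < n)%N ->
  \sum_j ghz_weight d c j = \sum_b d b.
Proof.
move=> hn; rewrite sum_unit_sum /= [in RHS](bigID (@is_rep n)) [X in _ + X](bigID
  (@is_rep n)) /=.
rewrite (eq_bigr (fun b => d b - c)) => [|b -> //].
rewrite [X in _ + (_ + X)](eq_bigr d) => [|b /negbTE -> //].
by rewrite !sum_rep //; ring.
Qed.

(** The bounds make every weight in [ghz_opE] nonnegative, so that decomposition is convex. *)
Lemma ghz_op_stab n (d : bits n -> R) c : (0 < n)%N ->
  0 <= c -> (forall b, 0 <= d b) -> (forall b, is_rep b -> c <= d b) ->
  \sum_b d b = 1 -> in_stab_poly (ghz_op d c).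
Proof.
move=> hn c0 d0 cd d1; rewrite ghz_opE; apply: in_stab_poly_mix.
- case=> [u|b] /=; first by rewrite mulr_ge0.
  by case: ifP => // hb; rewrite subr_ge0 cd.
- by rewrite ghz_weight_sum.
- by move=> j; apply: ghz_vec_stab.
Qed.

(** * The postselection and decoding procedure on matrix entries *)

Lemma opmul_deltal n (A B : op R n) (f : bits n -> bits n) (w : bits n -> C) :
  (forall a b, A a b = (b == f a)%:R * w a) ->
  opmul A B = fun a b => w a * B (f a) b.
Proof.
move=> h; apply/funext => a; apply/funext => b; rewrite /opmul (bigD1 (f a)) //=.
by rewrite h eqxx mul1r big1 ?addr0 // => x /negbTE hx; rewrite h hx !mul0r.
Qed.

Lemma opmul_deltar n (A B : op R n) (f : bits n -> bits n) (w : bits n -> C) :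
  (forall a b, B a b = (a == f b)%:R * w b) ->
  opmul A B = fun a b => A a (f b) * w b.
Proof.
move=> h; apply/funext => a; apply/funext => b; rewrite /opmul (bigD1 (f b)) //=.
by rewrite h eqxx mul1r big1 ?addr0 // => x /negbTE hx; rewrite h hx mul0r mulr0.
Qed.

(** Each factor is diagonal, with entry 1 where two neighbouring bits agree and 0 elsewhere;
    agreement along the whole chain means a constant string. *)
Lemma postsel_projE n a b :
  @postsel_proj R n a b = (a == b)%:R * (is_rep b)%:R.
Proof.
rewrite /postsel_proj.
have H (r : seq 'I_n.-1) x y :
   (\big[@opmul R n/@opI R n]_(j <- r) opscale (rc (1 / 2)) (opadd (@opI R n) (@ZZ R n
     j))) x y
   = (x == y)%:R * (all (fun j : 'I_n.-1 => bit y j == bit y j.+1) r)%:R.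
  elim: r x y => [|j r IH] x y; first by rewrite big_nil mulr1.
  rewrite big_cons (@opmul_deltal _ _ _ id (fun x => (bit x j == bit x j.+1)%:R)).
    rewrite IH /=; have [->|_] := eqVneq x y; last by rewrite !mul0r mulr0.
    by rewrite !mul1r; case: (_ == _); rewrite ?mul1r ?mul0r.
  move=> u v; rewrite /opscale /opadd /ZZ /opI [v == u]eq_sym.
  have [->|_] := eqVneq u v; last by rewrite !mul0r addr0 mulr0.
  rewrite rcM rcV rc1 rc_nat.
  by case: (_ == _) => /=; field.
rewrite H; congr (_ * (nat_of_bool _)%:R).
apply/allP/eqP => [h|e j _]; last first.
  have hn : (j.+1 < n)%N by rewrite -ltn_predRL.
  by rewrite e !bit_rep // ltnW.
apply: bitP => j; elim: j => [|j IH] hj; rewrite bit_rep //.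
have hj' : (j < n.-1)%N by rewrite ltn_predRL.
have /eqP <- := h (Ordinal hj') (mem_index_enum _).
by rewrite /= IH ?bit_rep // ltnW.
Qed.

Lemma post_unnormE n (rho : op R n) : post_unnorm rho = fun a b =>
  (is_rep a)%:R * rho a b * (is_rep b)%:R.
Proof.
rewrite /post_unnorm (@opmul_deltar _ _ _ id (fun b => (is_rep b)%:R));
  last exact: postsel_projE.
rewrite (@opmul_deltal _ _ _ id (fun b => (is_rep b)%:R)) // => a b.
by rewrite postsel_projE eq_sym; case: eqP => [->|]; rewrite // !mul0r.
Qed.

Definition fanout n (b : bits n) : bits n :=
  [tuple if (i : nat) == 0%N then tnth b i else tnth b i (+) bit b 0 | i < n].

Lemma bit_fanout n (b : bits n) j : (j < n)%N ->
  bit (fanout b) j = bit b j (+) (bit b 0 && (0 < j)%N).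
Proof.
move=> hj; rewrite (bit_tuple (fun i : 'I_n => if _ then _ else _) (Ordinal hj)) /=.
rewrite (tnth_nth false) /= -/(bit b j) lt0n.
by case: (j == 0%N); rewrite ?andbF ?addbF ?andbT.
Qed.

Lemma fanoutK n : involutive (@fanout n).
Proof.
move=> b; apply: bitP => j hj; have hn := leq_ltn_trans (leq0n j) hj.
by rewrite !bit_fanout // andbF addbF -addbA addbb addbF.
Qed.

Lemma cnot_chainE n a b : @cnot_chain R n a b = (a == fanout b)%:R.
Proof.
rewrite /cnot_chain /index_iota.
pose g (r : seq nat) (b : bits n) := foldr (cflip 0) b r.
have H r : all (fun t => (0 < t < n)%N) r -> forall a b,
    (\big[@opmul R n/@opI R n]_(t <- r) @CNOT R n 0 t) a b = (a == g r b)%:R.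
  elim: r => [_ x y|t r IH /= /andP[/andP[t0 tn] hr] x y]; first by rewrite big_nil.
  have ct : 0%N != t by rewrite eq_sym -lt0n.
  rewrite big_cons (@opmul_deltal _ _ _ (cflip 0 t) (fun=> 1)).
    by rewrite mul1r IH // (can2_eq (cflipK tn ct) (cflipK tn ct)).
  move=> u v; rewrite mulr1 /CNOT -/(cflip 0 t v) eq_sym.
  by rewrite (can2_eq (cflipK tn ct) (cflipK tn ct)).
have hr : all (fun t => (0 < t < n)%N) (iota 1 (n - 1)).
  apply/allP => t; rewrite mem_iota => /andP[t0 tn]; rewrite t0 /=.
  by move: tn; case: (n) => [|m]; rewrite ?subn1 ?add1n //; case: (t) t0.
rewrite H //; congr (_ == _)%:R; apply: bitP => j hj.
have bit_g r x k : all (fun t => (0 < t < n)%N) r ->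
    bit (g r x) k = bit x k (+) (bit x 0 && odd (count_mem k r)).
  elim: r k => [|t r IH] k /=; first by rewrite andbF addbF.
  case/andP=> /andP[t0 tn] {}hr; rewrite bit_cflip // !IH // oddD.
  (* Qubit 0 is never a target, so the control keeps its value along the chain. *)
  have -> : count_mem 0%N r = 0%N.
    apply/count_memPn/negP => h; by have := allP hr _ h.
  by rewrite andbF addbF [t == k]eq_sym oddb; case: (bit x 0); case: (k == t);
    case: (odd _); case: (bit x k).
rewrite bit_g // bit_fanout // count_uniq_mem ?iota_uniq // oddb mem_iota.
by rewrite subn1 add1n prednK ?hj ?andbT // (leq_ltn_trans _ hj).
Qed.

(** Only code words survive postselection, and [fanout] clears all their bits but the first. The
    discarded qubits then agree automatically, so each entry of the partial trace has a single
    nonzero candidate term. *)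
Lemma ptrace_chainE n (M : op R n) : (0 < n)%N ->
  ptrace_keep1 (opmul (opmul (@cnot_chain R n) (post_unnorm M))
                         (adj (@cnot_chain R n))) = restr M.
Proof.
move=> hn; apply/funext => a; apply/funext => b; rewrite /ptrace_keep1.
have e x y : opmul (opmul (@cnot_chain R n) (post_unnorm M)) (adj (@cnot_chain R n)) x y =
    post_unnorm M (fanout x) (fanout y).
  rewrite (@opmul_deltar _ _ _ (@fanout n) (fun=> 1)); last first.
    by move=> u v; rewrite /adj cnot_chainE conjc_nat mulr1 eq_sym (can2_eq (@fanoutK
      n) (@fanoutK n)).
  rewrite mulr1 (@opmul_deltal _ _ _ (@fanout n) (fun=> 1)) ?mul1r //.
  by move=> u v; rewrite cnot_chainE mulr1 eq_sym (can2_eq (@fanoutK n) (@fanoutK n)).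
have f0 (x : bits n) : bit (fanout x) 0 = bit x 0 by rewrite bit_fanout // andbF addbF.
have fx (x : bits n) c : is_rep (fanout x) -> bit x 0 = c -> x = fanout (rep n c).
  by move=> /eqP h <-; rewrite -[LHS]fanoutK h f0.
have bx c : bit (fanout (rep n c)) 0 = c by rewrite f0 bit_rep.
have hb c : behead (fanout (rep n c)) = nseq n.-1 false.
  apply: (@eq_from_nth _ false); first by rewrite size_behead size_tuple size_nseq.
  move=> i; rewrite size_behead size_tuple => hi.
  have hi' : (i.+1 < n)%N by rewrite -ltn_predRL.
  by rewrite nth_behead -/(bit _ i.+1) bit_fanout // !bit_rep // andbT addbb nth_nseq
    if_same.
rewrite (bigD1 (fanout (rep n (bit a 0)))) //= [X in _ + X]big1 ?addr0 => [|x hx];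
  last first.
  rewrite big1 // => y /and3P[/eqP xa _ _]; rewrite e post_unnormE.
  case hr : (is_rep (fanout x)); last by rewrite !mul0r.
  by move/eqP: hx; rewrite -(fx x _ hr xa).
rewrite (bigD1 (fanout (rep n (bit b 0)))) /=; last by rewrite !bx !hb !eqxx.
rewrite big1 ?addr0 => [|y /andP[/and3P[_ /eqP yb _] hy]]; last first.
  rewrite e post_unnormE; case hr : (is_rep (fanout y)); last by rewrite mulr0.
  by move/eqP: hy; rewrite -(fx y _ hr yb).
by rewrite e post_unnormE !fanoutK !is_rep_rep // mul1r mulr1.
Qed.

Lemma post_probE n (M : op R n) : (0 < n)%N ->
  post_prob M = M (rep n false) (rep n false) + M (rep n true) (rep n true).
Proof.
move=> hn; rewrite -(sum_rep (fun b => M b b)) // [RHS]big_mkcond /=.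
rewrite /post_prob /trace; apply: eq_bigr => b _; rewrite post_unnormE.
by case: (is_rep b); rewrite ?mul1r ?mulr1 // !mul0r.
Qed.

Lemma procedureE n (M : op R n) : (0 < n)%N -> procedure M =
  opscale (M (rep n false) (rep n false) + M (rep n true) (rep n true))^-1 (restr M).
Proof. by move=> hn; rewrite /procedure post_probE // ptrace_chainE. Qed.

(** * The damped GHZ state *)

Section AmplitudeDamping.
Variables (n : nat) (al be g : R).
Hypotheses (hn : (0 < n)%N) (g01 : 0 <= g <= 1).

(** The probability that damping takes the all-ones string to [b]. *)
Definition damped (b : bits n) : R := \prod_(j < n) if tnth b j then 1 - g else g.

Definition rho_diag (b : bits n) : R :=
  be ^+ 2 * damped b + (if b == rep n false then al ^+ 2 else 0).

Lemma damped_ge0 b : 0 <= damped b.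
Proof.
by apply: prodr_ge0 => j _; case: ifP => _; move: g01 => /andP[? ?]; rewrite ?subr_ge0.
Qed.

Lemma damped_sum : \sum_b damped b = 1.
Proof.
rewrite -(expr1n _ n) -[in RHS](card_ord n) -prodr_const.
(* Each factor of [1 ^+ n] is split as [(1 - g) + g]; expanding the product gives the sum over
   strings. *)
have e (j : 'I_n) : (1 : R) = \sum_(x : bool) if x then 1 - g else g.
  by rewrite big_bool /=; ring.
rewrite (eq_bigr _ (fun j _ => e j)) bigA_distr_bigA /=.
rewrite (reindex (fun f : {ffun 'I_n -> bool} => [tuple f i | i < n])) /=.
  by apply: eq_bigr => f _; apply: eq_bigr => j _; rewrite tnth_mktuple.
exists (fun b : bits n => [ffun i => tnth b i]) => [f _|b _].
  by apply/ffunP => i; rewrite ffunE tnth_mktuple.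
by apply: eq_from_tnth => i; rewrite tnth_mktuple ffunE.
Qed.

Lemma damped_rep c : damped (rep n c) = (if c then 1 - g else g) ^+ n.
Proof.
rewrite /damped (eq_bigr (fun=> if c then 1 - g else g));
  first by rewrite prodr_const card_ord.
by move=> j _; rewrite (tnth_nth false) /= nth_nseq ltn_ord.
Qed.

Lemma rho_diag_sum : al ^+ 2 + be ^+ 2 = 1 -> \sum_b rho_diag b = 1.
Proof.
move=> h; rewrite big_split /= -mulr_sumr damped_sum mulr1 -big_mkcond /= big_pred1_eq.
by rewrite addrC.
Qed.

Lemma rho_diag_ge0 b : 0 <= rho_diag b.
Proof.
apply: addr_ge0; first by rewrite mulr_ge0 ?sqr_ge0 ?damped_ge0.
by case: (_ == _); rewrite ?sqr_ge0.
Qed.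

Lemma rho_diag0 : rho_diag (rep n false) = P0 n al be g.
Proof. by rewrite /rho_diag eqxx damped_rep addrC. Qed.

Lemma rho_diag1 : rho_diag (rep n true) = Pn n al be g.
Proof. by rewrite /rho_diag rep_eq // damped_rep addr0. Qed.

Definition compl (b : bits n) : bits n := [tuple ~~ tnth b i | i < n].

Definition damp_amp (b : bits n) : R :=
  \prod_(j < n) Num.sqrt (if tnth b j then 1 - g else g).

Lemma damp_amp_sqr b : damp_amp b ^+ 2 = damped b.
Proof.
rewrite -prodrXl; apply: eq_bigr => j _; rewrite sqr_sqrtr //.
by case: ifP => _; move: g01 => /andP[? ?]; rewrite ?subr_ge0.
Qed.

Lemma prod_nat_all (F : 'I_n -> bool) :
  \prod_j ((F j)%:R : C) = ([forall j, F j])%:R.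
Proof.
case: forallP => h; first by rewrite big1 // => j _; rewrite h.
have [j hj] : exists j, ~~ F j by apply/existsP; rewrite -negb_forall; apply/forallP.
by rewrite (bigD1 j) //= (negbTE hj) mul0r.
Qed.

(** On the ground state one Kraus operator is the identity and the other gives zero, so only the
    all-zero Kraus string contributes. *)
Lemma krausN_rep0 k a :
  krausN g k a (rep n false) = (k == rep n false)%:R * (a == rep n false)%:R.
Proof.
have E (x : bits n) : [forall j, tnth x j == false] = (x == rep n false).
  apply/forallP/eqP => [h|-> j]; last by rewrite (tnth_nth false) /= nth_nseq if_same.
  by apply: eq_from_tnth => j; rewrite (eqP (h j)) (tnth_nth false) /= nth_nseq if_same.
rewrite -!E -!prod_nat_all -big_split; apply: eq_bigr => j _ /=.
rewrite (tnth_nth false (rep n false)) /= nth_nseq if_same /kraus andbF.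
by case: (tnth k j); case: (tnth a j); rewrite /= ?mul1r ?mul0r.
Qed.

(** Starting from all ones, a qubit ends in 0 exactly when it has decayed, so the output string
    determines the Kraus string. *)
Lemma krausN_rep1 k a :
  krausN g k a (rep n true) = (k == compl a)%:R * rc (damp_amp a).
Proof.
have -> : (k == compl a) = [forall j, tnth k j == ~~ tnth a j].
  apply/eqP/forallP => [-> j|h]; first by rewrite tnth_mktuple.
  by apply: eq_from_tnth => j; rewrite tnth_mktuple (eqP (h j)).
rewrite -prod_nat_all [rc _](rmorph_prod (real_complex R)) -big_split;
  apply: eq_bigr => j _ /=.
rewrite (tnth_nth false (rep n true)) /= nth_nseq ltn_ord /kraus andbT.
by case: (tnth k j); case: (tnth a j); rewrite /= ?mul1r ?mul0r.
Qed.

Lemma psiE b : @psi R n al be b =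
  if b == rep n false then rc al else if b == rep n true then rc be else 0.
Proof.
rewrite /psi.
have h c (p : pred bool) : (forall x, p x = (x == c)) -> all p b = (b == rep n c).
  move=> hp; rewrite (eq_all hp); apply/all_pred1P/eqP; rewrite size_tuple => e.
    exact: val_inj.
  by rewrite [in LHS]e.
rewrite (h false) => [|[]//]; rewrite (h true) => [|[]//].
by [].
Qed.

Lemma kraus_psi k a : \sum_b krausN g k a b * @psi R n al be b =
  rc al * (k == rep n false)%:R * (a == rep n false)%:R +
  rc be * (k == compl a)%:R * rc (damp_amp a).
Proof.
rewrite (bigID (@is_rep n)) /= [X in _ + X]big1 ?addr0 => [|b hb].
  rewrite sum_rep // krausN_rep0 krausN_rep1 !psiE !rep_eq // eqxx /=.
  by ring.
rewrite psiE; case: eqP => [e|_]; first by rewrite e is_rep_rep in hb.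
case: eqP => [e|_]; first by rewrite e is_rep_rep in hb.
by rewrite mulr0.
Qed.

(** Kraus string [k] sends the all-ones part to the complement of [k], and keeps the all-zero part
    only when [k] is all zeros. Different [k] do not interfere, so the sole coherence comes from the
    all-zero [k]. *)
Lemma rho_nE : @rho_n R n al be g = ghz_op rho_diag (coh n al be g).
Proof.
apply/funext => a; apply/funext => b; rewrite /rho_n /ampdamp.
pose f a (k : bits n) : C := rc al * (k == rep n false)%:R * (a == rep n false)%:R +
  rc be * (k == compl a)%:R * rc (damp_amp a).
transitivity (\sum_k f a k * conjc (f b k)).
  apply: eq_bigr => k _; rewrite /f -!kraus_psi rmorph_sum mulr_sumr /=.
  rewrite /opmul; apply: eq_bigr => c _; rewrite /adj rmorphM /=.
  by rewrite !mulr_suml; apply: eq_bigr => d _; rewrite /proj; ring.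
have fc (y k : bits n) : conjc (f y k) = f y k.
  by rewrite /f conjcD !conjcM !conjc_rc !conjc_nat.
have sum2 (x y : bits n) : \sum_k (k == x)%:R * (k == y)%:R = (x == y)%:R :> C.
  rewrite (bigD1 x) //= eqxx mul1r big1 ?addr0 // => k /negbTE ->.
  by rewrite mul0r.
pose A (x : bits n) : C := (x == rep n false)%:R.
(* A product of two indicators of [k] sums to one indicator. The cross terms in the middle require
   one string to be all zeros and the other all ones. *)
have -> : \sum_k f a k * conjc (f b k) =
    rc al * rc al * A a * A b +
    rc al * rc be * (A a * rc (damp_amp b) * (rep n false == compl b)%:R +
                     A b * rc (damp_amp a) * (rep n false == compl a)%:R) +
    rc be * rc be * rc (damp_amp a) * rc (damp_amp b) * (compl a == compl b)%:R.
  pose D x (k : bits n) : C := (k == x)%:R.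
  transitivity (rc al * rc al * A a * A b * (\sum_k D (rep n false) k * D (rep n false)
    k) +
    rc al * rc be * A a * rc (damp_amp b) * (\sum_k D (rep n false) k * D (compl b) k) +
    rc al * rc be * A b * rc (damp_amp a) * (\sum_k D (rep n false) k * D (compl a) k) +
    rc be * rc be * rc (damp_amp a) * rc (damp_amp b) * (\sum_k D (compl a) k * D
      (compl b) k)).
    rewrite !mulr_sumr -!big_split /=; apply: eq_bigr => k _; rewrite fc /f.
    rewrite -/(A a) -/(A b) -/(D (rep n false) k) -/(D (compl a) k) -/(D (compl b) k).
    by ring.
  by rewrite /D !sum2 eqxx /=; ring.
have inj_compl : injective compl.
  move=> x y e; apply: eq_from_tnth => i; apply: negb_inj.
  by have := congr1 (fun z => tnth z i) e; rewrite !tnth_mktuple.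
have c1 : rep n false = compl (rep n true).
  by apply: eq_from_tnth => i; rewrite tnth_mktuple !(tnth_nth false) /= !nth_nseq
    ltn_ord.
have amp1 : damp_amp (rep n true) = Num.sqrt (1 - g) ^+ n.
  rewrite /damp_amp (eq_bigr (fun=> Num.sqrt (1 - g)));
    first by rewrite prodr_const card_ord.
  by move=> j _; rewrite (tnth_nth false) /= nth_nseq ltn_ord.
rewrite c1 !(inj_eq inj_compl) /ghz_op /A /coh.
have [<-|ab] := eqVneq a b.
  rewrite /rho_diag -damp_amp_sqr eq_sym rcD !expr2 !rcM.
  have [->|_] := eqVneq a (rep n false); first by rewrite rep_eq //=; rewrite rcM; ring.
  by rewrite rc0 /=; ring.
case: ifP => [/andP[/eqP ea /eqP eb]|hab].
  move: ab; rewrite ea eb; case: (bit a 0); case: (bit b 0); rewrite ?eqxx // => _;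
  by rewrite !rep_eq //= !amp1 !rcM; ring.
have h x y : is_rep x && is_rep y = false ->
    ((x == rep n false)%:R * (rep n true == y)%:R = 0 :> C).
  move=> hxy; case: eqP => [ex|_]; last by rewrite mul0r.
  case: eqP => [ey|_]; last by rewrite mulr0.
  by rewrite ex -ey !is_rep_rep in hxy.
have h2 : (a == rep n false)%:R * (b == rep n false)%:R = 0 :> C.
  case: eqP => [ea|_]; last by rewrite mul0r.
  case: eqP => [eb|_]; last by rewrite mulr0.
  by rewrite ea eb eqxx in ab.
rewrite -[_ * _ * (a == _)%:R * _]mulrA h2 rc0 mulr0 add0r mulr0 addr0.
by rewrite (mulrAC (a == _)%:R) h // (mulrAC (b == _)%:R) h ?mul0r ?addr0 ?mulr0 // andbC.
Qed.

End AmplitudeDamping.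
End States.

(** * Comparison of the robustness before and after the procedure *)

Section Robustness.
Variable R : realType.

(** The set whose infimum is [robustness]. *)
Definition decomp_cost n (rho : op R n) : set R :=
  [set r : R | exists (k : nat) (q : 'I_k -> R) (sigma : 'I_k -> op R n),
    [/\ forall j, in_stab_poly (sigma j), rho = mix q sigma &
        r = \sum_j `|q j| ]]%classic.

Lemma decomp_cost_mix n (T : finType) (q : T -> R) (s : T -> op R n) :
  (forall j, in_stab_poly (s j)) -> decomp_cost (mix q s) (\sum_j `|q j|).
Proof.
move=> hs; exists #|T|, (q \o enum_val), (s \o enum_val); split => /= [j||] //.
  by apply/funext => a; apply/funext => b; rewrite /mix [LHS]sum_enum_val.
by rewrite (sum_enum_val (fun j => `|q j|)).
Qed.

Lemma decomp_cost_lb n (rho : op R n) : has_lbound (decomp_cost rho).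
Proof. by exists 0 => r [k [q [s [_ _ ->]]]]; apply: sumr_ge0. Qed.

Lemma trace_mix n (T : finType) (q : T -> R) (s : T -> op R n) :
  (forall j, in_stab_poly (s j)) -> trace (mix q s) = rc (\sum_j q j).
Proof.
move=> hs; rewrite /trace /mix exchange_big /= rc_sum; apply: eq_bigr => j _.
by rewrite -mulr_sumr -[X in _ * X]/(trace (s j)) trace_stab ?mulr1.
Qed.

Lemma rcI : injective (@rc R).
Proof. exact: complexI. Qed.

Variables (n : nat) (d : bits n -> R) (c : R).
Hypotheses (hn : (0 < n)%N) (d0 : forall b, 0 <= d b) (d1 : \sum_b d b = 1).
Let p := d (rep n false) + d (rep n true).
Hypothesis p0 : 0 < p.
Let rho := ghz_op d c.
Let rt := opscale (rc p)^-1 (restr rho).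

Lemma restr_ghz : restr rho = ghz_op (fun a => d (rep n (bit a 0))) c.
Proof.
apply/funext => a; apply/funext => b; rewrite /restr /rho /ghz_op !is_rep_rep //
  !is_rep1 rep_eq //.
congr rc; congr (if _ then _ else _); rewrite [a in RHS]bits1E [b in RHS]bits1E.
by apply/eqP/eqP => [->|[]].
Qed.

Lemma cond_ghz : rt = ghz_op (fun a => d (rep n (bit a 0)) / p) (c / p).
Proof.
rewrite /rt restr_ghz; apply/funext => a; apply/funext => b.
rewrite /opscale /ghz_op -rcV -rcM mulrC !is_rep1.
by congr rc; case: ifP.
Qed.

(** The decomposition [ghz_opE], possibly with negative weights, is a witness; it keeps [inf] away
    from its default value on the empty set. *)
Lemma decomp_cost_cond_nonempty : (decomp_cost rt !=set0)%classic.
Proof.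
rewrite cond_ghz ghz_opE; eexists; apply: decomp_cost_mix => j.
by apply/in_stab_poly_proj/ghz_vec_stab.
Qed.

Lemma non_rep_sum : \sum_(b | ~~ is_rep b) d b = 1 - p.
Proof. by rewrite -d1 [X in _ = X - _](bigID (@is_rep n)) /= sum_rep // -/p addrAC
  subrr add0r. Qed.

(** Encode every term with its weight scaled by [p], and add the diagonal entries outside the code
    as basis projectors; these are nonnegative and cost exactly [1 - p]. *)
Lemma decomp_cost_embed r : decomp_cost rt r -> decomp_cost rho (p * r + (1 - p)).
Proof.
case=> k [q [s [hs e ->]]].
pose q' (j : 'I_k + bits n) :=
  match j with inl j => p * q j | inr b => if is_rep b then 0 else d b end.
pose s' (j : 'I_k + bits n) :=
  match j with inl j => @embop R n (s j) | inr b => proj (@ket R n b) end.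
have hs' j : in_stab_poly (s' j).
  case: j => [j|b] /=; first exact: embop_stab.
  exact/in_stab_poly_proj/stab_ket.
have := decomp_cost_mix q' hs'; congr decomp_cost; last first.
  rewrite big_sumType /= mulr_sumr; congr (_ + _).
    by apply: eq_bigr => j _; rewrite normrM gtr0_norm.
  rewrite -non_rep_sum [RHS]big_mkcond; apply: eq_bigr => b _.
  by case: (is_rep b); rewrite ?normr0 // ger0_norm.
apply/funext => a; apply/funext => b; rewrite /mix big_sumType /=.
rewrite [X in _ + X](bigD1 a) //= [X in _ + (_ + X)]big1 ?addr0 => [|x hx]; last first.
  by rewrite /proj /ket eq_sym (negbTE hx) mul0r mulr0.
rewrite /proj /ket eqxx mul1r conjc_nat.
have -> : \sum_j rc (p * q j) * @embop R n (s j) a b =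
    if is_rep a && is_rep b then rho a b else 0.
  rewrite /embop; case: ifP => [/andP[ha hb]|_]; last by rewrite big1 // => j _;
    rewrite mulr0.
  transitivity (rc p * rt [tuple bit a 0] [tuple bit b 0]).
    by rewrite e /mix mulr_sumr; apply: eq_bigr => j _; rewrite rcM mulrA.
  rewrite /rt /opscale mulrA -rcV -rcM divff ?gt_eqF // rc1 mul1r /restr.
  by congr rho; apply/esym/eqP.
rewrite /rho /ghz_op [b == a]eq_sym; have [<-|_] := eqVneq a b.
  by rewrite andbb mulr1; case: (is_rep a); rewrite ?rc0 ?addr0 ?add0r.
by rewrite mulr0 addr0; case: (_ && _); rewrite ?rc0.
Qed.

(* Strong monotonicity for this measurement: the failed branches of a
   decomposition carry total signed weight [1 - p], hence cost at least [1 - p]. *)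
Lemma decomp_cost_postselect r : decomp_cost rho r ->
  exists2 r', decomp_cost rt r' & p * r' + (1 - p) <= r.
Proof.
case=> k [q [s [hs e ->]]].
have /fin_all_exists [f hf] : forall j, exists mt : R * op R 1,
    [/\ 0 <= mt.1 <= 1, in_stab_poly mt.2 &
    restr (s j) = (fun a b => rc mt.1 * mt.2 a b)].
  by move=> j; have [m [t H]] := restr_stab hn (hs j); exists (m, t).
have rE : restr rho = mix (fun j => q j * (f j).1) (fun j => (f j).2).
  rewrite e; apply/funext => a; apply/funext => b; rewrite /restr /mix.
  apply: eq_bigr => j _; have [_ _ h] := hf j.
  by have := congr1 (fun w => w a b) h; rewrite /restr => ->; rewrite rcM mulrA.
have hf2 j : in_stab_poly (f j).2 by have [] := hf j.
have q1 : \sum_j q j = 1.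
  apply: rcI; rewrite -(trace_mix _ hs) -e /trace -d1 rc_sum.
  by apply: eq_bigr => b _; rewrite /rho /ghz_op eqxx.
have qp : \sum_j q j * (f j).1 = p.
  apply: rcI; rewrite -(trace_mix _ hf2) -rE restr_ghz /trace sum_bits1.
  by rewrite /ghz_op !eqxx /p rcD.
exists (\sum_j `|q j * (f j).1 / p|).
  have -> : rt = mix (fun j => q j * (f j).1 / p) (fun j => (f j).2).
    rewrite /rt rE; apply/funext => a; apply/funext => b; rewrite /opscale /mix mulr_sumr.
    by apply: eq_bigr => j _; rewrite mulrA -rcV -rcM mulrC [p^-1 * _]mulrC mulrC.
  exact: decomp_cost_mix.
(* The lost weight is spread over the terms. With [m] the block factor of a term of weight [q], the
   inequality [|q| m + q (1 - m) <= |q|] settles each term. *)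
have -> : 1 - p = \sum_j q j * (1 - (f j).1).
  transitivity (\sum_j q j - \sum_j q j * (f j).1); first by rewrite q1 qp.
  by rewrite -sumrB; apply: eq_bigr => j _; rewrite mulrBr mulr1.
rewrite mulr_sumr -big_split /=; apply: ler_sum => j _.
have [/andP[m0 m1] _ _] := hf j.
rewrite normrM normfV (gtr0_norm p0) mulrC divfK ?gt_eqF // normrM (ger0_norm m0).
have := ler_wpM2r (_ : 0 <= 1 - (f j).1) (ler_norm (q j)).
by rewrite subr_ge0 => /(_ m1); lra.
Qed.

(** Up to the affine map [r -> p * r + (1 - p)], [decomp_cost_postselect] gives one inequality
    between the infima and [decomp_cost_embed] the other. *)
Lemma robustness_cond : p * (robustness rt - 1) = robustness rho - 1.
Proof.
rewrite /robustness -/(decomp_cost rt) -/(decomp_cost rho).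
have [r hr] := decomp_cost_cond_nonempty.
apply/eqP; rewrite eq_le; apply/andP; split.
  suff : p * inf (decomp_cost rt) + (1 - p) <= inf (decomp_cost rho) by lra.
  apply: lb_le_inf; first by exists (p * r + (1 - p)); apply: decomp_cost_embed.
  move=> x /decomp_cost_postselect [r' hr' hx]; apply: le_trans hx.
  by rewrite lerD2r ler_pM2l //; apply: ge_inf => //; exact: decomp_cost_lb.
suff : (inf (decomp_cost rho) - (1 - p)) / p <= inf (decomp_cost rt).
  by rewrite ler_pdivrMr // [_ * p]mulrC; lra.
apply: lb_le_inf; first by exists r.
move=> x /decomp_cost_embed hx; rewrite ler_pdivrMr // mulrC lerBlDr.
by apply: ge_inf => //; exact: decomp_cost_lb.
Qed.

(** Necessity is [stab_poly_dominated] applied to each row of the block; sufficiency is the explicit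
    mixture of [ghz_op_stab]. *)
Lemma ghz_stabP : 0 <= c ->
  in_stab_poly rho <-> c <= Num.min (d (rep n false)) (d (rep n true)).
Proof.
move=> c0; rewrite le_min; split=> [h|/andP[c1 c2]].
  apply/andP; split.
    apply: (@stab_poly_dominated R n rho (rep n false) (rep n true) _ _ h).
      by rewrite /rho /ghz_op rep_eq // !is_rep_rep.
    by rewrite /rho /ghz_op eqxx.
  apply: (@stab_poly_dominated R n rho (rep n true) (rep n false) _ _ h).
    by rewrite /rho /ghz_op rep_eq // !is_rep_rep.
  by rewrite /rho /ghz_op eqxx.
by apply: ghz_op_stab => // b /eqP ->; case: (bit b 0).
Qed.

End Robustness.

(** * The octahedron in Bloch coordinates, and assembly of the theorem *)

Lemma bloch_octahedronP (R : realType) (x z : R) :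
  in_octahedron (bloch x 0 z) <-> `|x| + `|z| <= 1.
Proof.
split=> [[x' [y' [z' [h e]]]]|h]; last first.
  by exists x, 0, z; split => //; rewrite normr0 addr0.
have := congr1 (fun w => w [tuple false] [tuple false]) e.
have := congr1 (fun w => w [tuple false] [tuple true]) e.
rewrite /bloch /opI /pauliX /pauliY /pauliZ /bit /= => -[ex _] [ez _].
(* Two entries of the first row determine the coordinates: the real part of the off-diagonal one
   gives [x], the diagonal one gives [z]. *)
have -> : x = x' by lra.
have -> : z = z' by lra.
by apply: le_trans h; rewrite lerD2r lerDl.
Qed.

Theorem theorem2 (R : realType) (n : nat) (al be g : R) :
  (2 <= n)%N -> 0 < al -> 0 < be -> al ^+ 2 + be ^+ 2 = 1 ->
  0 <= g <= 1 ->
  let rho := @rho_n R n al be g in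
  let p0 := P0 n al be g in
  let pn := Pn n al be g in
  let c := coh n al be g in
  let rt := procedure rho in
  let x := 2 * c / (p0 + pn) in
  let z := (p0 - pn) / (p0 + pn) in
  [/\ post_prob rho = rc (p0 + pn),
      al ^+ 2 <= p0 + pn,
      rt = rho_tilde_formula n al be g &
      rt = bloch x 0 z] /\
  [/\ (~ in_stab_poly rho <-> ~ in_octahedron rt),
      (~ in_octahedron rt <-> 1 < `|x| + `|z|),
      (1 < `|x| + `|z| <-> Num.min p0 pn < c) &
      (p0 + pn) * (robustness rt - 1) = robustness rho - 1].
Proof.
move=> n2 al0 be0 ab1 g01 rho p0 pn c rt x z.
have hn : (0 < n)%N by apply: leq_trans n2.
have /andP[g0 g1] := g01.
pose d := @rho_diag R n al be g.
have d0 : d (rep n false) = p0 by exact: rho_diag0.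
have d1 : d (rep n true) = pn by exact: rho_diag1.
have c0 : 0 <= c by rewrite /c /coh !mulr_ge0 ?exprn_ge0 ?sqrtr_ge0 // ltW.
have pn0 : 0 <= pn by rewrite mulr_ge0 ?sqr_ge0 ?exprn_ge0 ?subr_ge0.
have hp : al ^+ 2 <= p0 + pn.
  by rewrite /p0 /P0 -addrA lerDl addr_ge0 // mulr_ge0 ?sqr_ge0 ?exprn_ge0.
have p_gt0 : 0 < p0 + pn by apply: lt_le_trans hp; rewrite exprn_gt0.
have rhoE : rho = ghz_op d c by exact: rho_nE.
have rhoc b : rho (rep n b) (rep n b) = rc (d (rep n b)) by rewrite rhoE /ghz_op eqxx.
have hpp : post_prob rho = rc (p0 + pn).
  by rewrite post_probE // !rhoc d0 d1 rcD.
have rtE : rt = opscale (rc (p0 + pn))^-1 (restr (ghz_op d c)).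
  by rewrite /rt procedureE // !rhoc d0 d1 -rcD -rhoE.
have rt2 : rt = rho_tilde_formula n al be g.
  rewrite rtE restr_ghz //; apply/funext => a; apply/funext => b.
  rewrite /opscale /rho_tilde_formula -rcV /ghz_op !is_rep1 /=; congr (_ * rc _).
  have -> : (a == b) = (bit a 0 == bit b 0).
    by apply/eqP/eqP => [-> //|e]; rewrite (bits1E a) (bits1E b) e.
  by case: (bit a 0); case: (bit b 0).
have rt3 : rt = bloch x 0 z.
  rewrite rt2; apply/funext => a; apply/funext => b.
  rewrite /rho_tilde_formula /bloch /opI /pauliX /pauliY /pauliZ.
  have -> : (a == b) = (bit a 0 == bit b 0).
    by apply/eqP/eqP => [-> //|e]; rewrite (bits1E a) (bits1E b) e.
  rewrite -/p0 -/pn -/c rc0 mul0r addr0 -rcM.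
  by case: (bit a 0); case: (bit b 0); rewrite /= ?mulr1 ?mulr0 ?mul1r ?mul0r ?addr0
    ?add0r;
    rewrite ?mulrN1 -?rc1 -?rcN -?rcD -?rcM ?mulr0 ?rc0 ?addr0 -?rcM;
    congr rc; rewrite /x /z; field; rewrite gt_eqF.
(* Clearing the denominator leaves [p0 + pn < 2 c + |p0 - pn|], and [p0 + pn - |p0 - pn|] is twice
   the minimum. *)
have xz : 1 < `|x| + `|z| <-> Num.min p0 pn < c.
  have -> : `|x| = 2 * c / (p0 + pn) by apply: ger0_norm; apply: divr_ge0;
    [exact: mulr_ge0 | exact: ltW].
  have -> : `|z| = `|p0 - pn| / (p0 + pn) by rewrite /z normrM normfV (gtr0_norm p_gt0).
  rewrite -mulrDl.
  rewrite ltr_pdivlMr // mul1r; have [h|h] := lerP p0 pn.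
    by split; lra.
  by split; lra.
have oct : ~ in_octahedron rt <-> 1 < `|x| + `|z|.
  rewrite rt3 ltNge; split=> [h|/negP h]; last by move/bloch_octahedronP.
  by apply/negP => /bloch_octahedronP.
have st : ~ in_stab_poly rho <-> Num.min p0 pn < c.
  have := @ghz_stabP R n d c hn (fun b => rho_diag_ge0 al be g01 b) (rho_diag_sum n g
    ab1) c0.
  rewrite d0 d1 -rhoE ltNge => -[h1 h2].
  by split=> [h|/negP h /h1 //]; apply/negP => /h2.
split; split => //.
  by split=> [/st/xz/oct|/oct/xz/st].
have := @robustness_cond R n d c hn (fun b => rho_diag_ge0 al be g01 b) (rho_diag_sum n
  g ab1).
by rewrite d0 d1 -rtE -rhoE; apply.
Qed.
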